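(* Let $k\ge 3$ be an integer and let $\epsilon>0$ with $k-1-\epsilon>1$. There exists a $(k-1-\epsilon)$-stable instance $\{G=(V,E),w,T\}$ of \texttt{k-terminal cut} with $T=\{t_1,\ldots,t_k\}$ and (unique) optimal source sets $(S_1^*,\ldots,S_k^* )$ such that, for every $i\in\{1,\ldots,k\}$, the source set $Q_i$ of the $t_i$-isolating cut satisfies $Q_i=\{t_i\}\neq S_i^*$.
   Context: An instance $\{G=(V,E),w,T\}$ of \texttt{k-terminal cut} consists of an undirected graph $G=(V,E)$, a weight function $w:E\to\mathbb{R}^+$, and a set $T=\{t_1,\ldots,t_k\}\subseteq V$ of $k$ distinct terminals. The problem is to remove a minimum-weight set of edges so that no path connects any two terminals. Equivalently, a feasible solution is a partition $(S_1,\ldots,S_k)$ of $V$ with $t_i\in S_i$ (source sets), cutting all edges between different parts; $(S_1^*,\ldots,S_k^* )$ denotes the optimal one. For $\gamma>1$, a $\gamma$-perturbation of $(G,w)$ is the same graph with weights $w'$ satisfying $w(e)\le w'(e)\le\gamma w(e)$ for all $e\in E$. The instance is $\gamma$-stable if there is an optimal solution which is the unique optimal \texttt{k-terminal cut} solution for every $\gamma$-perturbation. The $t_i$-isolating cut is a minimum $(s,t)$-cut separating $s=t_i$ from all other terminals (with $T\setminus\{t_i\}$ merged into a single sink $t$); its source set $Q_i$ is the set of vertices remaining connected to $t_i$ after removing the cut edges. *)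

(* Defs.v *)
From HB Require Import structures.
From mathcomp Require Import all_boot all_order all_algebra.
From mathcomp Require Import reals.

Set Implicit Arguments.
Unset Strict Implicit.
Unset Printing Implicit Defensive.

Import Order.TTheory GRing.Theory Num.Theory.
Local Open Scope ring_scope.

(* The graph is finite, simple and undirected: an edge is a two-element set of
   vertices. The values of [weight] outside [edges] are irrelevant. The
   terminals t_1, ..., t_k are indexed by 'I_k. *)
Record instance (R : realType) (k : nat) := Instance {
  vertex : finType;
  edges : {set {set vertex}};
  weight : {set vertex} -> R;
  terminal : 'I_k -> vertex;
  card_edge : forall e, e \in edges -> #|e| = 2%N;
  weight_gt0 : forall e, e \in edges -> 0 < weight e;
  terminal_inj : injective terminal
}.
Arguments weight {R k} _ _.

Section KTerminalCut.
Variables (R : realType) (k : nat) (I : instance R k).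
Local Notation V := (vertex I).
Implicit Types (w : {set V} -> R) (S : {ffun 'I_k -> {set V}}).
Implicit Types (C : {set {set V}}) (Q : {set V}).

Definition edges_weight w C : R := \sum_(e in C) w e.

Definition feasible S : Prop :=
  [/\ forall i, terminal I i \in S i,
      forall i j, i != j -> [disjoint S i & S j]
    & \bigcup_(i < k) S i = [set: V]].

(* For a feasible S, these are the edges joining two different parts. *)
Definition cut_edges S : {set {set V}} :=
  [set e in edges I | ~~ [exists i, e \subset S i]].

Definition optimal w S : Prop :=
  feasible S /\
  forall S', feasible S' ->
    edges_weight w (cut_edges S) <= edges_weight w (cut_edges S').

Definition unique_optimal w S : Prop :=
  optimal w S /\ forall S', optimal w S' -> S' = S.

Definition perturbation (gamma : R) w : Prop :=
  forall e, e \in edges I -> weight I e <= w e <= gamma * weight I e.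

Definition stable (gamma : R) : Prop :=
  exists S, optimal (weight I) S /\
    forall w, perturbation gamma w -> unique_optimal w S.

Definition adjacent_without C : rel V :=
  fun x y => [set x; y] \in edges I :\: C.

Definition remaining_connected C (x : V) : {set V} :=
  [set y | connect (adjacent_without C) x y].

(* Separating t_i from every other terminal is the same as separating it from
   the single sink obtained by merging the other terminals. *)
Definition isolates (i : 'I_k) C : Prop :=
  C \subset edges I /\
  forall j, j != i -> terminal I j \notin remaining_connected C (terminal I i).

Definition isolating_cut (i : 'I_k) C : Prop :=
  isolates i C /\
  forall C', isolates i C' ->
    edges_weight (weight I) C <= edges_weight (weight I) C'.

(* A minimum cut need not be unique in general, hence a relation. *)
Definition isolating_source_set (i : 'I_k) Q : Prop :=
  exists2 C, isolating_cut i C & Q = remaining_connected C (terminal I i).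

End KTerminalCut.

(* Main.v *)
(* Take a complete bipartite graph between the terminals t_1, ..., t_k and k
   further vertices s_1, ..., s_k, where t_j s_j has weight a and every other
   edge has weight 1, with k - 1 - eps < a < k - 1. In a k-terminal cut every
   s_j independently keeps one of its edges, and a exceeds k - 1 - eps times
   any other weight at s_j, so under every perturbation it keeps t_j s_j. For
   the t_i-isolating cut, separating s_j from t_i costs the one edge t_i s_j,
   whereas leaving s_j on the side of t_i costs all its other edges: k - 1 > a
   if j = i, and a + k - 2 > 1 otherwise. *)

Require Import Defs.
From mathcomp Require Import all_boot all_order all_algebra.
From mathcomp Require Import reals.
From mathcomp Require Import lra.

Set Implicit Arguments.
Unset Strict Implicit.
Unset Printing Implicit Defensive.

Import Order.TTheory GRing.Theory Num.Theory.
Local Open Scope ring_scope.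

(** * The bipartite instance and its edges *)

Section Bipartite.
Variables (R : realType) (k : nat) (a : R).
Hypothesis a_gt0 : 0 < a.

(** [inl j] is the terminal t_j and [inr j] is the vertex s_j. *)
Definition bvertex : finType := ('I_k + 'I_k)%type.

Definition bedge (p : 'I_k * 'I_k) : {set bvertex} := [set inl p.1; inr p.2].

Definition bedges : {set {set bvertex}} := [set bedge p | p : 'I_k * 'I_k].

Definition bweight (e : {set bvertex}) : R :=
  if [exists j, e == bedge (j, j)] then a else 1.

Lemma bedge_inj : injective bedge.
Proof.
move=> [l j] [l' j'] /setP eqE.
have /esym := eqE (inl l); rewrite !inE eqxx orbF => /eqP[->].
by have /esym := eqE (inr j); rewrite !inE eqxx => /eqP[->].
Qed.

Lemma bweightE l j : bweight (bedge (l, j)) = if l == j then a else 1.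
Proof.
rewrite /bweight; congr (if _ then _ else _).
apply/existsP/eqP => [[m /eqP/bedge_inj[-> ->]] //|->].
by exists j.
Qed.

Lemma card_bedge e : e \in bedges -> #|e| = 2%N.
Proof. by case/imsetP=> p _ ->; rewrite cards2. Qed.

Lemma bweight_gt0 e : e \in bedges -> 0 < bweight e.
Proof. by move=> _; rewrite /bweight; case: ifP. Qed.

Lemma inl_injective : injective (inl : 'I_k -> bvertex).
Proof. by move=> i j []. Qed.

Definition bipartite : instance R k :=
  Instance card_bedge bweight_gt0 inl_injective.

Lemma bedge_in p : bedge p \in edges bipartite.
Proof. exact: imset_f. Qed.

(** Grouping edges by their endpoint s_j lets cuts be compared one s_j at a time. *)
Lemma edges_weight_bipartite (w : {set vertex bipartite} -> R)
    (C : {set {set vertex bipartite}}) :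
  C \subset edges bipartite ->
  edges_weight w C =
  \sum_j \sum_(l | bedge (l, j) \in C) w (bedge (l, j)).
Proof.
move=> /subsetP sCE.
have {1}-> : C = [set bedge p | p in [set p | bedge p \in C]].
  apply/setP=> e; apply/idP/imsetP => [eC|[p]].
    by have /imsetP[p _ eE] := sCE e eC; exists p; rewrite // inE -eE.
  by rewrite inE => pC ->.
rewrite /edges_weight big_imset /=; last by move=> p q _ _; apply: bedge_inj.
rewrite (exchange_big_dep predT) //= pair_big_dep /=.
by apply: eq_big => [[l j]|[l j] _] //; rewrite inE.
Qed.

(** * Optimal k-terminal cuts and stability *)

Definition assign (f : 'I_k -> 'I_k) : {ffun 'I_k -> {set vertex bipartite}} :=
  [ffun i => [set x : vertex bipartite |
    match x with inl l => l == i | inr j => f j == i end]].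

Lemma assign_feasible f : feasible (assign f).
Proof.
split=> [i|i j neq_ij|]; first by rewrite ffunE inE /=.
- rewrite -setI_eq0; apply/eqP/setP => x; rewrite !ffunE !inE.
  by apply: contraNF neq_ij; case: x => x /andP[/eqP <- /eqP <-].
apply/setP => x; rewrite inE; apply/bigcupP.
by case: x => [l|j]; [exists l | exists (f j)]; rewrite // ffunE inE.
Qed.

(** The parts of the terminals are forced, so the only freedom is which part each s_j joins. *)
Lemma feasible_assign S : feasible S -> exists f, S = assign f.
Proof.
move=> [tS disjS covS].
have eqS x i j : x \in S i -> x \in S j -> i = j.
  move=> xi xj; apply/eqP; apply: contraLR xj => /disjS disj_ij.
  by rewrite (disjointFr disj_ij xi).
have /fin_all_exists[f fP] j : exists i, (inr j : vertex bipartite) \in S i.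
  have : (inr j : vertex bipartite) \in \bigcup_(i < k) S i by rewrite covS inE.
  by case/bigcupP=> i _; exists i.
exists f; apply/ffunP => i; rewrite ffunE; apply/setP => x; rewrite inE.
have memS y m : y \in S m -> (y \in S i) = (m == i).
  by move=> ym; apply/idP/eqP => [/(eqS _ _ _ ym)//|<-].
by case: x => [l|j]; apply: memS; [exact: tS | exact: fP].
Qed.

(** Among the edges at s_j, only the one to the terminal of its own part survives; the cost thus
    splits into terms depending on one [f j] each. *)
Lemma cut_weight_assign w f :
  edges_weight w (cut_edges (assign f)) =
  \sum_j (\sum_l w (bedge (l, j)) - w (bedge (f j, j))).
Proof.
rewrite edges_weight_bipartite; last first.
  by apply/subsetP => e; rewrite inE => /andP[].
apply: eq_bigr => j _; rewrite [X in _ = X - _](bigD1 (f j)) //=.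
rewrite addrAC subrr add0r.
apply: eq_bigl => l; rewrite inE bedge_in /=; congr (~~ _).
apply/existsP/eqP => [[i]|->].
  rewrite ffunE => /subsetP sub; have := sub (inl l); have := sub (inr j).
  by rewrite !inE /= !eqxx => /(_ isT)/eqP-> /(_ isT)/eqP->.
by exists (f j); apply/subsetP => x; rewrite ffunE !inE => /orP[] /eqP->.
Qed.

Lemma assign_id_unique_optimal (w : {set vertex bipartite} -> R) :
  (forall l j, l != j -> w (bedge (l, j)) < w (bedge (j, j))) ->
  unique_optimal w (assign id).
Proof.
move=> wlt.
have wle f j : \sum_l w (bedge (l, j)) - w (bedge (j, j)) <=
               \sum_l w (bedge (l, j)) - w (bedge (f j, j)).
  by rewrite lerD2l lerN2; have [->//|/wlt/ltW] := eqVneq (f j) j.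
split=> [|S' [/feasible_assign[f ->] /(_ _ (assign_feasible id))]].
  split=> [|S' /feasible_assign[f ->]]; first exact: assign_feasible.
  by rewrite !cut_weight_assign ler_sum.
rewrite !cut_weight_assign => le_cut.
suff fE : f =1 id.
  by apply/ffunP => i; rewrite !ffunE; apply/setP => -[] x; rewrite !inE ?fE.
move=> j; apply/eqP; apply: contraLR le_cut => neq_fj; rewrite -ltNge.
(* A single misplaced s_j costs strictly more, and no other term can compensate. *)
rewrite (bigD1 j) //= [ltRHS](bigD1 j) //=; apply: ltr_leD.
  by rewrite ltrD2l ltrN2 wlt.
exact: ler_sum.
Qed.

(** For l different from j, w(t_l s_j) <= gamma < a <= w(t_j s_j). *)
Lemma bipartite_perturbation (gamma : R) (w : {set vertex bipartite} -> R) :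
  gamma < a -> perturbation gamma w -> unique_optimal w (assign id).
Proof.
move=> gamma_lt wP; apply: assign_id_unique_optimal => l j /negbTE neq_lj.
have /andP[_] := wP _ (bedge_in (l, j)).
have /andP[+ _] := wP _ (bedge_in (j, j)).
rewrite /= !bweightE eqxx neq_lj mulr1 => le_a le_gamma.
exact: le_lt_trans le_gamma (lt_le_trans gamma_lt le_a).
Qed.

(** * Isolating cuts *)

Definition star (i : 'I_k) : {set {set vertex bipartite}} :=
  [set bedge (i, j) | j : 'I_k].

Lemma in_star i l j : (bedge (l, j) \in star i) = (l == i).
Proof.
by apply/imsetP/eqP => [[m _ /bedge_inj[]]//|->]; exists j.
Qed.

Lemma remaining_connected_star (C : {set {set vertex bipartite}}) i :
  star i \subset C ->
  remaining_connected C (terminal bipartite i) = [set terminal bipartite i].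
Proof.
move=> /subsetP sC; apply/setP => y; rewrite !inE.
apply/connectP/eqP => [[[|z p] /=]|->]; last by exists [::].
  by move=> _ ->.
(* The first edge of a path leaving t_i contains t_i, hence lies in [star i] and has been
   removed. *)
rewrite /adjacent_without inE.
move=> /andP[/andP[/negP ziC /imsetP[[l j] _ ziE]] _] _.
case: ziC; apply: sC; rewrite ziE in_star.
by have /setP/(_ (inl i))/esym := ziE;
  rewrite !inE eqxx orbF eq_sym => /eqP[->].
Qed.

Lemma star_isolates i : isolates i (star i).
Proof.
split=> [|j neq_ji].
  by apply/subsetP => e /imsetP[j _ ->]; apply: bedge_in.
by rewrite remaining_connected_star // inE; apply: contra neq_ji => /eqP[->].
Qed.

Lemma edges_weight_star w i :
  edges_weight w (star i) = \sum_j w (bedge (i, j)).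
Proof.
rewrite edges_weight_bipartite; last by have [] := star_isolates i.
by apply: eq_bigr => j _; rewrite (eq_bigl _ _ (in_star i ^~ j)) big_pred1_eq.
Qed.

(** Otherwise the path t_i, s_j, t_l would survive. *)
Lemma isolates_edge i (C : {set {set vertex bipartite}}) l j :
  isolates i C -> l != i ->
  bedge (i, j) \notin C -> bedge (l, j) \in C.
Proof.
move=> [_ isoC] neq_li ijC; apply: contraR (isoC l neq_li) => ljC.
rewrite inE; apply: (@connect_trans _ _ (inr j : vertex bipartite)).
  by apply: connect1; rewrite /adjacent_without inE ijC (bedge_in (i, j)).
apply: connect1; rewrite /adjacent_without setUC inE.
by rewrite ljC (bedge_in (l, j)).
Qed.

(** Leaving s_j with t_i is strictly dearer than cutting it off; strictness is what determines the
    source set of every minimum cut. *)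
Hypothesis bypass_gt : forall i j,
  bweight (bedge (i, j)) < \sum_(l | l != i) bweight (bedge (l, j)).

Lemma isolates_local_gt i (C : {set {set vertex bipartite}}) j :
  isolates i C -> bedge (i, j) \notin C ->
  bweight (bedge (i, j)) <
  \sum_(l | bedge (l, j) \in C) bweight (bedge (l, j)).
Proof.
move=> isoC ijC; rewrite (eq_bigl (fun l => l != i)) // => l.
have [->|neq_li] := eqVneq l i; first exact: negbTE.
exact: isolates_edge isoC neq_li ijC.
Qed.

Lemma isolates_local_ge i (C : {set {set vertex bipartite}}) j : isolates i C ->
  bweight (bedge (i, j)) <=
  \sum_(l | bedge (l, j) \in C) bweight (bedge (l, j)).
Proof.
move=> isoC; have [ijC|ijC] := boolP (bedge (i, j) \in C); last first.
  exact/ltW/isolates_local_gt.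
rewrite (bigD1 i) //= lerDl sumr_ge0 // => l _.
exact/ltW/bweight_gt0/imset_f.
Qed.

Lemma star_isolating_cut i : isolating_cut i (star i).
Proof.
split=> [|C isoC]; first exact: star_isolates.
rewrite edges_weight_star edges_weight_bipartite; last by have [] := isoC.
by apply: ler_sum => j _; apply: isolates_local_ge.
Qed.

(** A cut missing t_i s_j pays strictly more than the star at s_j and at least as much at every
    other vertex, so it is not minimum. *)
Lemma isolating_cut_star i (C : {set {set vertex bipartite}}) :
  isolating_cut i C -> star i \subset C.
Proof.
move=> [isoC minC]; apply/subsetP => e /imsetP[j _ ->].
have := minC _ (star_isolates i); apply: contraLR => ijC; rewrite -ltNge.
rewrite edges_weight_star edges_weight_bipartite; last by have [] := isoC.
rewrite (bigD1 j) //= [ltRHS](bigD1 j) //=; apply: ltr_leD.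
  exact: isolates_local_gt.
by apply: ler_sum => m _; apply: isolates_local_ge.
Qed.

Lemma bipartite_isolating_source_set i (Q : {set vertex bipartite}) :
  isolating_source_set i Q <-> Q = [set terminal bipartite i].
Proof.
split=> [[C /isolating_cut_star sC ->]|->].
  exact: remaining_connected_star.
exists (star i); first exact: star_isolating_cut.
by rewrite remaining_connected_star.
Qed.

End Bipartite.

(** * Choice of the weight [a] *)

Lemma bypass_weight_gt (R : realType) (k : nat) (a : R) (i j : 'I_k) :
  (3 <= k)%N -> 1 < a -> a < k%:R - 1 ->
  bweight a (bedge (i, j)) < \sum_(l | l != i) bweight a (bedge (l, j)).
Proof.
move=> hk a_gt1 a_lt.
have w_ge1 l : 1 <= bweight a (bedge (l, j)).
  by rewrite bweightE; case: ifP; lra.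
(* The k - 1 other edges at s_j weigh at least 1 each, while t_i s_j weighs [a] or 1, both below k -
   1. *)
have le_sum : k%:R - 1 <= \sum_(l | l != i) bweight a (bedge (l, j)).
  have -> : k%:R - 1 = \sum_(l < k | l != i) (1 : R).
    rewrite sumr_const cardC1 card_ord -subn1 natrB //.
    exact: leq_trans hk.
  exact: ler_sum.
apply: lt_le_trans le_sum; rewrite bweightE; case: ifP => _ //.
exact: lt_trans a_lt.
Qed.

Theorem theorem2 (R : realType) (k : nat) (eps : R)
    (hk : (3 <= k)%N) (heps : 0 < eps) (hgamma : 1 < k%:R - 1 - eps) :
  exists (I : instance R k) (S : {ffun 'I_k -> {set vertex I}}),
    [/\ stable I (k%:R - 1 - eps),
        unique_optimal (weight I) S
      & forall i : 'I_k,
          (forall Q : {set vertex I},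
             isolating_source_set i Q <-> Q = [set terminal I i]) /\
          [set terminal I i] <> S i].
Proof.
(* The midpoint of k - 1 - eps and k - 1: the lower bound gives stability, the upper one the trivial
   isolating source sets. *)
pose a : R := k%:R - 1 - eps / 2.
have a_gt1 : 1 < a by rewrite /a; lra.
have a_gt0 : 0 < a by lra.
have a_gt : k%:R - 1 - eps < a by rewrite /a; lra.
have a_lt : a < k%:R - 1 by rewrite /a; lra.
have opt_w : unique_optimal (weight (bipartite k a_gt0)) (assign a_gt0 id).
  (* The original weights are a perturbation of themselves, as the factor exceeds 1. *)
  apply: (bipartite_perturbation a_gt) => e eE.
  by rewrite lexx ler_peMl ?ltW ?weight_gt0.
exists (bipartite k a_gt0), (assign a_gt0 id); split=> // [|i].
  exists (assign a_gt0 id); split; first by case: opt_w.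
  by move=> w; apply: bipartite_perturbation.
split=> [Q|].
  by apply: bipartite_isolating_source_set => l j; apply: bypass_weight_gt.
(* The vertex s_i lies in the optimal part of t_i. *)
by move=> /setP/(_ (inr i)); rewrite ffunE !inE eqxx.
Qed.
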